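(* Let $S=\mathbb{C}[x_0,\ldots,x_n]$ and $T=\mathbb{C}[X_0,\ldots,X_n]$. Let $\mathcal{M}=\{M_j\}_{j\in J}$ be a finite nonempty collection of monomials $M_j=x_0^{a_{0,j}}x_1^{a_{1,j}}\cdots x_n^{a_{n,j}}\in S$ with $a_{i,j}\ge 1$ for every $i\in\{0,\ldots,n\}$ and every $j\in J$. Then for any $i\in\{0,\ldots,n\}$, setting $$I=(X_i)+\bigcap_{j\in J}M_j^{\perp}\subset T,$$ the simultaneous Waring rank satisfies $\mathrm{rk}_{\mathbb{C}}\,\mathcal{M}\ \ge\ \dim_{\mathbb{C}} T/I$, where $T/I$ is a finite $\mathbb{C}$-algebra.
   Context: Here $n$ is a nonnegative integer, and a form is a homogeneous polynomial. The ring $T=\mathbb{C}[X_0,\ldots,X_n]$ acts on $S=\mathbb{C}[x_0,\ldots,x_n]$ by differentiation, with $X_i$ acting as $\partial/\partial x_i$. For a form $F\in S$, its apolar ideal is $F^{\perp}=\{G\in T : G(F)=0\}\subset T$. For a finite collection of forms $\mathcal{F}=\{F_1,\ldots,F_s\}$ (degrees not necessarily equal), the simultaneous Waring rank $\mathrm{rk}_{\mathbb{C}}\,\mathcal{F}$ is the minimal integer $r$ such that there exist linear forms $L_1,\ldots,L_r\in S$ with the property that every $F_i$ can be written as $F_i=\sum_{j=1}^r\lambda_{i,j}L_j^{d_i}$ with $d_i=\deg F_i$ and $\lambda_{i,j}\in\mathbb{C}$. *)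

(* Defs.v *)
From HB Require Import structures.
From mathcomp Require Import all_boot all_order all_algebra.
From mathcomp Require Import ssrcomplements.
From mathcomp Require Export boolp classical_sets reals complex mpoly.

Set Implicit Arguments.
Unset Strict Implicit.
Unset Printing Implicit Defensive.

Import GRing.Theory.

Local Open Scope ring_scope.
Local Open Scope quotient_scope.

(* MathComp's {quot S} is only a zmodType; when S is a submodule the scalar
   action descends to it.  A vectType cannot be used here, since polynomial
   rings are not finite-dimensional. *)
Section ModuleQuotient.
Variables (K : pzRingType) (V : lmodType K) (S : submodClosed V).

(* submodClosed does not inherit from zmodClosed. *)
Definition submod_pred : {pred V} := S.

Fact submod_pred_zmod : zmod_closed submod_pred.
Proof.
split=> [|u v Su Sv]; first exact: rpred0.
by rewrite -scaleN1r; apply: rpredD => //; apply: rpredZ.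
Qed.

HB.instance Definition _ := GRing.isZmodClosed.Build V submod_pred submod_pred_zmod.

Definition mod_quot : Type := Quotient.quot submod_pred.

HB.instance Definition _ := GRing.Zmodule.on mod_quot.

Definition mod_pi (v : V) : mod_quot := \pi_(Quotient.quot submod_pred) v.

Definition mod_scale (c : K) (u : mod_quot) : mod_quot :=
  mod_pi (c *: repr (u : Quotient.quot submod_pred)).

Lemma mod_piP (u v : V) : (mod_pi u = mod_pi v) <-> (u - v \in S).
Proof.
by rewrite -[_ \in S]/(_ \in submod_pred) Quotient.idealrBE; split=> /eqP.
Qed.

Lemma mod_pi_surj (u : mod_quot) : exists v, u = mod_pi v.
Proof. by exists (repr (u : Quotient.quot submod_pred)); rewrite /mod_pi reprK. Qed.

Lemma mod_piD (u v : V) : mod_pi (u + v) = mod_pi u + mod_pi v.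
Proof. exact: (raddfD (\pi_(Quotient.quot submod_pred))). Qed.

Lemma mod_piZ (c : K) (v : V) : mod_pi (c *: v) = mod_scale c (mod_pi v).
Proof.
by apply/mod_piP; rewrite -scalerBr rpredZ //; apply/mod_piP; rewrite /mod_pi reprK.
Qed.

Fact mod_scaleA a b u : mod_scale a (mod_scale b u) = mod_scale (a * b) u.
Proof. by have [v ->] := mod_pi_surj u; rewrite -!mod_piZ scalerA. Qed.

Fact mod_scale1 : left_id 1 mod_scale.
Proof. by move=> u; have [v ->] := mod_pi_surj u; rewrite -mod_piZ scale1r. Qed.

Fact mod_scaleDr : right_distributive mod_scale +%R.
Proof.
move=> c u v; have [x ->] := mod_pi_surj u; have [y ->] := mod_pi_surj v.
by rewrite -mod_piD -!mod_piZ scalerDr mod_piD.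
Qed.

Fact mod_scaleDl u : {morph mod_scale^~ u : a b / a + b}.
Proof.
by move=> a b; have [v ->] := mod_pi_surj u; rewrite -!mod_piZ scalerDl mod_piD.
Qed.

HB.instance Definition _ := GRing.Zmodule_isLmodule.Build K mod_quot
  mod_scaleA mod_scale1 mod_scaleDr mod_scaleDl.

Fact mod_pi_is_linear : linear mod_pi.
Proof. by move=> c u v; rewrite mod_piD mod_piZ. Qed.

HB.instance Definition _ := GRing.isLinear.Build K V mod_quot _ mod_pi
  mod_pi_is_linear.

End ModuleQuotient.

Section Apolarity.
Variables (K : fieldType) (n : nat).
Implicit Types (F G H p q : {mpoly K[n]}).

(* The polynomial G of T acts on F in S by substituting d/dx_i for X_i;
   S and T are both represented by {mpoly K[n]}. *)
Definition diff_action G F : {mpoly K[n]} :=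
  \sum_(m <- msupp G) G@_m *: F^`M[m].

Lemma diff_actionE k G F : (msize G <= k)%N ->
  diff_action G F = \sum_(m : 'X_{1..n < k}) G@_m *: F^`M[m].
Proof.
move=> leGk; rewrite /diff_action (big_mksub ('X_{1..n < k} : subFinType _)) /=.
- by rewrite big_rmcond //= => i; move/memN_msupp_eq0 ->; rewrite scale0r.
- by rewrite msupp_uniq.
- by move=> x /msize_mdeg_lt /leq_trans; apply.
Qed.

Definition diff_actionl F G := diff_action G F.

Fact diff_actionl_is_linear F : linear (diff_actionl F).
Proof.
move=> c G H; rewrite /diff_actionl; pose k := maxn (msize (c *: G + H)) (maxn (msize G) (msize H)).
rewrite !(@diff_actionE k) ?leq_max ?leqnn ?orbT //.
rewrite scaler_sumr -big_split /=; apply: eq_bigr => m _.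
by rewrite mcoeffD mcoeffZ scalerDl scalerA.
Qed.

Fact diff_action_is_linear G : linear (diff_action G).
Proof.
move=> c F H; rewrite /diff_action scaler_sumr -big_split /=.
apply: eq_bigr => m _.
by rewrite linearP scalerDr !scalerA mulrC.
Qed.

HB.instance Definition _ F := GRing.isLinear.Build K {mpoly K[n]} {mpoly K[n]} _
  (diff_actionl F) (diff_actionl_is_linear F).
HB.instance Definition _ G := GRing.isLinear.Build K {mpoly K[n]} {mpoly K[n]} _
  (diff_action G) (diff_action_is_linear G).

Lemma diff_actionX m F : diff_action 'X_[m] F = F^`M[m].
Proof. by rewrite /diff_action msuppX big_seq1 mcoeffX eqxx scale1r. Qed.

Lemma diff_actionM G H F : diff_action (G * H) F = diff_action G (diff_action H F).
Proof.
rewrite -[LHS]/(diff_actionl F _) {1}[G]mpolyE mulr_suml raddf_sum /=.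
rewrite {2}/diff_action; apply: eq_bigr => m _.
rewrite -scalerAl linearZ_LR /=; congr (_ *: _).
rewrite {1}[H]mpolyE mulr_sumr raddf_sum /diff_action raddf_sum /=.
apply: eq_bigr => m' _; rewrite -scalerAr linearZ_LR mderivmZ /=.
by rewrite /diff_actionl -mpolyXD diff_actionX addmC mderivmDm.
Qed.

Definition apolar_ideal F : {pred {mpoly K[n]}} :=
  [pred G | diff_action G F == 0].

Definition principal_ideal p : {pred {mpoly K[n]}} :=
  [pred G | `[< exists q, G = q * p >]].

Definition ideal_sum (A B : {pred {mpoly K[n]}}) : {pred {mpoly K[n]}} :=
  [pred G | `[< exists p q, [/\ p \in A, q \in B & G = p + q] >]].

Definition ideal_bigcap (J : finType) (A : J -> {pred {mpoly K[n]}}) :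
    {pred {mpoly K[n]}} :=
  [pred G | [forall j, G \in A j]].

Definition apolar_sum_ideal (J : finType) (F : J -> {mpoly K[n]}) (i : 'I_n) :
    {pred {mpoly K[n]}} :=
  ideal_sum (principal_ideal 'X_i) (ideal_bigcap (fun j => apolar_ideal (F j))).

Section SumIdeal.
Variables (J : finType) (F : J -> {mpoly K[n]}) (i : 'I_n).

Lemma apolar_sum_idealP G :
  reflect (exists p q, (forall j, diff_action q (F j) = 0) /\ G = p * 'X_i + q)
          (G \in apolar_sum_ideal F i).
Proof.
apply: (iffP (asboolP _)) => [[_ [q [/asboolP[p ->] /forallP h ->]]]|].
  by exists p, q; split=> // j; apply/eqP/h.
case=> p [q [h ->]]; exists (p * 'X_i), q; split=> //.
  by apply/asboolP; exists p.
by apply/forallP => j; apply/eqP.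
Qed.

Lemma apolar_sum_ideal_mull H G :
  G \in apolar_sum_ideal F i -> H * G \in apolar_sum_ideal F i.
Proof.
move=> /apolar_sum_idealP[p [q [h ->]]]; apply/apolar_sum_idealP.
exists (H * p), (H * q); split; last by rewrite mulrDr mulrA.
by move=> j; rewrite diff_actionM h raddf0.
Qed.

Fact apolar_sum_ideal_submod : submod_closed (apolar_sum_ideal F i).
Proof.
split.
  apply/apolar_sum_idealP; exists 0, 0; split; last by rewrite mul0r addr0.
  by move=> j; exact: (raddf0 (diff_actionl (F j))).
move=> c G H /apolar_sum_idealP[p [q [hq ->]]] /apolar_sum_idealP[r [s [hs ->]]].
apply/apolar_sum_idealP; exists (c *: p + r), (c *: q + s); split.
  move=> j; rewrite -[LHS]/(diff_actionl (F j) _) linearP /= /diff_actionl.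
  by rewrite hq hs scaler0 addr0.
by rewrite scalerDr mulrDl scalerAl addrACA.
Qed.

HB.instance Definition _ := GRing.isSubmodClosed.Build K {mpoly K[n]}
  (apolar_sum_ideal F i) (GRing.submod_closed_semi apolar_sum_ideal_submod).

End SumIdeal.

(* The scalars multiply L_k ^ deg (F_j), where deg p is (msize p).-1. *)
Definition simultaneous_waring (J : finType) (F : J -> {mpoly K[n]}) (r : nat) :=
  exists L : 'I_r -> {mpoly K[n]}, (forall k, L k \is 1.-homog) /\
  exists lambda : J -> 'I_r -> K,
    forall j, F j = \sum_(k < r) lambda j k *: L k ^+ (msize (F j)).-1.

(* The least r admitting a simultaneous decomposition.  Over a field of
   characteristic 0 every finite family of forms has one; the junk value 0 is
   taken if there is none. *)
Definition simultaneous_waring_rank (J : finType) (F : J -> {mpoly K[n]}) : nat :=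
  xget 0%N (fun r => simultaneous_waring F r /\
                     forall s, simultaneous_waring F s -> (r <= s)%N).

End Apolarity.

(* Main.v *)
(* The ideal I is spanned by monomials, so T/I has as a basis the set D of
   monomials X^m with m_i = 0 dividing some M_j.
   Lower bound: if the powers of L_1, ..., L_r span all the M_j and r < #|D|,
   some nonzero combination g of D, homogenised by powers of X_i with one extra
   factor X_i, vanishes at the coefficient vectors of all the L_k.  The
   homogeneous polynomial so obtained kills every power of every L_k, hence
   every M_j.  But if m is a monomial of top degree in g then X^m X_i has a
   nonzero coefficient in it, and still divides some M_j because a_{i,j} >= 1.
   That the rank is attained (and is not the junk value 0) comes from the
   polarization identity, writing a monomial as a combination of powers of
   sums of variables. *)
From HB Require Import structures.
Require Import Defs.
From mathcomp Require Import all_boot all_order all_algebra.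
Import GRing.Theory.
Local Open Scope ring_scope.

(** * Induction on monomials and the polarization identity *)

Lemma mnm_addU_ind (n : nat) (P : 'X_{1..n} -> Prop) :
  P 0%MM -> (forall i m, P m -> P (U_(i) + m)%MM) -> forall m, P m.
Proof.
move=> P0 PU m; move: {-1}(mdeg m) (erefl (mdeg m)) => d.
elim: d m => [|d IH] m dm; first by move/eqP: dm; rewrite mdeg_eq0 => /eqP ->.
have [i mi] : exists i, m i != 0%N.
  apply/existsP; apply: contra_eqT dm => /existsPn m0.
  by rewrite mdegE big1 // => i _; apply/eqP; rewrite -[_ == _]negbK.
have em : (U_(i) + (m - U_(i)) = m)%MM by rewrite addmC submK ?lep1mP.
rewrite -em; apply/PU/IH; apply/eqP.
by rewrite -eqSS -dm -{2}em mdegD mdeg1.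
Qed.

(* Expand the product over i of (1 - [i not in B]). *)
Lemma sum_superset_sign (A : comNzRingType) (I : finType) (B : {set I}) :
  \sum_(S : {set I} | B \subset S) (-1) ^+ #|~: S| = (B == setT)%:R :> A.
Proof.
have -> : (B == setT)%:R = \prod_(i : I) (1 + - (i \notin B)%:R) :> A.
  case: eqP => [->|/eqP]; first by rewrite big1 // => i _; rewrite inE subr0.
  rewrite -subTset => /subsetPn [i _ iB].
  by rewrite (bigD1 i) //= iB subrr mul0r.
rewrite bigA_distr big_mkcond /=; apply: eq_bigr => S _.
rewrite (bigID (mem S)) /= big1 ?mul1r; last by move=> i ->.
case: ifP => [/subsetP BS | /negbT /subsetPn [i iB iS]].
  rewrite -prodr_const big_mkcond [RHS]big_mkcond /=; apply: eq_bigr => i _.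
  rewrite inE; case: ifPn => // iS.
  by case: (boolP (i \in B)) => [/BS|_]; rewrite ?(negPf iS).
by rewrite (bigD1 i) //= (negPf iS) iB oppr0 mul0r.
Qed.

(** Each power expands over the maps [f] from ['I_d] to itself with image in [S]. After exchanging
    the sums, the signs over the sets [S] containing the image cancel unless [f] is onto, that is, a
    permutation; each of the [d]! permutations contributes the same product. *)
Lemma polarization (A : comNzRingType) (d : nat) (y : 'I_d -> A) :
  \sum_(S : {set 'I_d}) (-1) ^+ #|~: S| * (\sum_(i in S) y i) ^+ d
    = d`!%:R * \prod_i y i.
Proof.
pose img (f : {ffun 'I_d -> 'I_d}) := [set f i | i : 'I_d].
transitivity (\sum_(S : {set 'I_d}) \sum_(f : {ffun 'I_d -> 'I_d} | img f \subset S)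
                (-1) ^+ #|~: S| * \prod_i y (f i)).
  apply: eq_bigr => S _; rewrite -mulr_sumr; congr (_ * _).
  have -> (x : A) : x ^+ d = \prod_(i < d) x by rewrite prodr_const card_ord.
  rewrite bigA_distr_big; apply: eq_bigl => f.
  apply/ffun_onP/subsetP => [fS _ /imsetP [i _ ->] //|fS i].
  by apply/fS/imsetP; exists i.
rewrite (exchange_big_dep xpredT) //=.
under eq_bigr => f _ do rewrite -mulr_suml sum_superset_sign.
have imgE f : (img f == setT) = injectiveb f.
  apply/eqP/injectiveP => [fT | finj].
    have /imset_injP f_inj : #|[set f i | i : 'I_d]| == #|'I_d|.
      by rewrite -/(img f) fT cardsT.
    by move=> i k; apply: f_inj.
  by apply/eqP; rewrite eqEcard subsetT cardsT card_imset /=.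
rewrite (bigID (fun f : {ffun 'I_d -> 'I_d} => injectiveb f)) /= addrC.
rewrite big1 ?add0r; last first.
  by move=> f; rewrite imgE => /negPf ->; rewrite mul0r.
rewrite (eq_bigr (fun=> \prod_i y i)) => [|f finj].
  rewrite sumr_const mulr_natl; congr (_ *+ _).
  have := card_inj_ffuns 'I_d 'I_d; rewrite card_ord ffactnn => <-.
  by apply: eq_card => f; rewrite !inE.
by rewrite imgE finj mul1r; symmetry; apply/reindex_inj/injectiveP.
Qed.

(** * Differentiation of powers of linear forms and of monomials *)

Section Apolarity.
Variables (K : fieldType) (n : nat).
Hypothesis charK0 : [pchar K] =i pred0.
Implicit Types (F G L : {mpoly K[n]}) (m a : 'X_{1..n}).

Lemma natr_neq0 d : (0 < d)%N -> d%:R != 0 :> K.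
Proof. by move: charK0 => /pcharf0P ->; rewrite lt0n. Qed.

Definition linear_coef L (i : 'I_n) : K := L@_(U_(i)).

Lemma mderiv_linear L i : L \is 1.-homog -> L^`M(i) = (linear_coef L i)%:MP.
Proof.
move=> Lhom; apply/mpolyP => m; rewrite mcoeff_deriv mcoeffC.
case: eqVneq => [->|m0]; first by rewrite mnm0E add0m mulr1.
rewrite mulr0 (dhomog_nemf_coeff Lhom) ?mul0rn //= mdegD mdeg1 addn1 eqSS.
by rewrite mdeg_eq0.
Qed.

Lemma mderiv_linear_exp L d i : L \is 1.-homog ->
  (L ^+ d)^`M(i) = (d%:R * linear_coef L i) *: L ^+ d.-1.
Proof.
move=> Lhom; elim: d => [|d IH]; first by rewrite expr0 mderivC mul0r scale0r.
rewrite exprS mderivM IH mderiv_linear // mul_mpolyC -scalerAr.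
case: d {IH} => [|d]; first by rewrite mul0r scale0r addr0 mul1r.
by rewrite -exprS -scalerDl -[d.+2]add1n natrD mulrDl mul1r.
Qed.

(** The truncated subtraction is harmless: when [mdeg m] exceeds [d], the falling factorial is 0. *)
Lemma mderivm_linear_exp L d m : L \is 1.-homog ->
  (L ^+ d)^`M[m] = ((d ^_ mdeg m)%:R * ('X_[m]).@[linear_coef L]) *: L ^+ (d - mdeg m).
Proof.
move=> Lhom; elim/mnm_addU_ind: m d => [|i m IH] d.
  by rewrite mderivm0m mdeg0 mpolyX0 meval1 mulr1 scale1r subn0.
rewrite mderivmDm mderivmU1m mdegD mdeg1 mpolyXD mevalM mevalXU.
rewrite mderiv_linear_exp // linearZ /= IH scalerA add1n.
case: d => [|d]; first by rewrite ffact0n !mul0r.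
by rewrite ffactSS natrM subSS mulrACA.
Qed.

(** Homogeneity gives all terms of [G] the same falling factorial and the same power of [L]. Hence a
    form vanishing at the coefficient vector of [L] kills every power of [L]. *)
Lemma diff_action_linear_exp G L d t : L \is 1.-homog -> G \is t.-homog ->
  diff_action G (L ^+ d) =
    ((d ^_ t)%:R * G.@[linear_coef L]) *: L ^+ (d - t).
Proof.
move=> Lhom Ghom; rewrite /diff_action mevalE.
rewrite mulr_sumr scaler_suml; apply: eq_big_seq => m mG.
rewrite mderivm_linear_exp // (dhomog_mf Ghom mG) scalerA mevalX.
by congr (_ *: _); rewrite mulrCA.
Qed.

(** No cancellation can occur: distinct divisors [m] of [a] send the monomial to multiples of
    distinct monomials [a - m], nonzero in characteristic 0, and all other [m] kill it. *)
Lemma apolar_monomialP G a :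
  diff_action G 'X_[a] = 0 <-> (forall m, (m <= a)%MM -> G@_m = 0).
Proof.
split=> [Ga m ma | Ga].
  have [mG|] := boolP (m \in msupp G); last by move/memN_msupp_eq0.
  have := congr1 (mcoeff (a - m)) Ga.
  rewrite mcoeff0 /diff_action raddf_sum /= (big_rem m) //= big_seq big1.
    rewrite addr0 mcoeffZ mcoeff_mderivm addmC submK // mcoeffX eqxx.
    move/eqP; rewrite mulf_eq0 => /orP [/eqP //|].
    rewrite (negPf (natr_neq0 _ _)) // prodn_gt0 // => i.
    by rewrite ffact_gt0; apply/mnm_lepP.
  move=> p; rewrite mem_rem_uniq ?msupp_uniq // inE => /andP [pm _].
  rewrite mcoeffZ mcoeff_mderivm mcoeffX.
  case: eqVneq => [e|_]; last by rewrite mul0rn mulr0.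
  case/eqP: pm; apply: (@addIm _ (a - m)%MM).
  by rewrite -e addmC submK.
rewrite /diff_action big_seq big1 // => m mG.
have [ma|] := boolP (m <= a)%MM; first by rewrite Ga // scale0r.
move=> /mnm_lepP ma; rewrite mderivmX.
have [i mi] : exists i, (a i < m i)%N.
  by apply/existsP; apply: contra_notT ma => /existsPn h i; rewrite leqNgt.
by rewrite (bigD1 i) //= ffact_small // mul0n scale0r scaler0.
Qed.

(** Listing the variables with multiplicity supplies the arguments of the polarization identity. *)
Lemma mpolyX_prod_vars m :
  exists y : 'I_(mdeg m) -> 'I_n, 'X_[m] = \prod_k 'X_(y k) :> {mpoly K[n]}.
Proof.
have [s sm] : exists s : seq 'I_n, m = (\sum_(i <- s) U_(i))%MM.
  elim/mnm_addU_ind: m => [|i m [s ->]]; first by exists [::]; rewrite big_nil.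
  by exists (i :: s); rewrite big_cons.
have : mdeg m = size s.
  by rewrite sm mdeg_sum -sum1_size; apply: eq_bigr => i _; rewrite mdeg1.
have -> : 'X_[m] = \prod_(i <- s) 'X_i :> {mpoly K[n]}.
  by rewrite sm; apply: (big_morph _ (@mpolyXD n K)); apply: mpolyX0.
move: (mdeg m) => d ->.
by exists (tnth (in_tuple s)); rewrite big_tnth.
Qed.


(** * Existence of simultaneous decompositions of monomials *)

Section Monomials.
Variables (J : finType) (a : J -> 'X_{1..n}).
Let M j : {mpoly K[n]} := 'X_[a j].

Lemma simultaneous_waring_monomials : exists r, simultaneous_waring M r.
Proof.
(* Every monomial gets its own block of linear forms, one per subset of its list of variables; the
   scalars for [j] vanish off block [j]. *)
pose T := {j : J & {set 'I_(mdeg (a j))}}.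
pose y j := sval (cid (mpolyX_prod_vars (a j))).
have yE j : M j = \prod_k 'X_(y j k) := svalP (cid (mpolyX_prod_vars (a j))).
pose t (k : 'I_#|{: T}|) : T := enum_val k.
exists #|{: T}|, (fun k => \sum_(i in tagged (t k)) 'X_(y (tag (t k)) i)); split.
  by move=> k; apply: rpred_sum => i _; rewrite dhomogX /= mdeg1.
exists (fun j k => if tag (t k) == j then
    (mdeg (a j))`!%:R^-1 * (-1) ^+ #|~: tagged (t k)| else 0) => j.
pose F j' (S : {set 'I_(mdeg (a j'))}) : {mpoly K[n]} :=
  (if j' == j then (mdeg (a j))`!%:R^-1 * (-1) ^+ #|~: S| else 0)
    *: (\sum_(i in S) 'X_(y j' i)) ^+ mdeg (a j).
transitivity (\sum_(u : T) F (tag u) (tagged u)); last first.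
  by rewrite (reindex _ (onW_bij _ (enum_val_bij T))) /M msizeX.
rewrite -(sig_big_dep xpredT (fun=> xpredT) F) /= (bigD1 j) //=.
rewrite [X in _ + X]big1 ?addr0 => [|j' /negPf jj']; last first.
  by rewrite big1 // => S _; rewrite /F jj' scale0r.
under eq_bigr => S _ do rewrite /F eqxx -scalerA -[X in _ *: X]mul_mpolyC rmorphXn rmorphN1.
rewrite -scaler_sumr polarization -yE.
rewrite mulr_natl -scaler_nat scalerA mulVf ?scale1r //.
by rewrite natr_neq0 ?fact_gt0.
Qed.


(** * The monomial basis of the quotient and the lower bound it gives *)

Variable i : 'I_n.

(** It exceeds the degree of every divisor of the monomials, so these divisors lie in a finite
    type. *)
Definition exponent_bound := (\max_j mdeg (a j)).+1.

Definition standard_exponents : {set 'X_{1..n < exponent_bound}} :=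
  [set m : 'X_{1..n < exponent_bound} | (m i == 0%N) && [exists j, (m <= a j)%MM]].

Let D := standard_exponents.

Lemma divisor_mdeg_bound m j : (m <= a j)%MM -> (mdeg m < exponent_bound)%N.
Proof.
move=> /mnm_lepP ma; rewrite ltnS (leq_trans _ (leq_bigmax j)) //.
by rewrite !mdegE leq_sum.
Qed.

Definition standard_exponent (k : 'I_#|D|) : 'X_{1..n} := enum_val k.

Lemma standard_exponent_inj : injective standard_exponent.
Proof. exact/(inj_comp val_inj)/enum_val_inj. Qed.

Lemma standard_exponent_var k : standard_exponent k i = 0%N.
Proof. by have := enum_valP k; rewrite inE => /andP [/eqP]. Qed.

Lemma standard_exponent_dvd k : exists j, (standard_exponent k <= a j)%MM.
Proof. by have := enum_valP k; rewrite inE => /andP [_ /existsP]. Qed.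

Lemma standard_exponent_surj m j :
  m i = 0%N -> (m <= a j)%MM -> exists k, standard_exponent k = m.
Proof.
move=> mi mj; pose m' := BMultinom (divisor_mdeg_bound m j mj).
have m'D : m' \in D by rewrite inE mi; apply/existsP; exists j.
by exists (enum_rank_in m'D m'); rewrite /standard_exponent enum_rankK_in.
Qed.

Definition standard_coefs G : 'rV[K]_#|D| := \row_k G@_(standard_exponent k).

Lemma standard_coefs_linear : linear standard_coefs.
Proof. by move=> c p q; apply/rowP => k; rewrite !mxE mcoeffD mcoeffZ. Qed.

Lemma mcoeff_mulXU_eq0 G m : m i = 0%N -> (G * 'X_i)@_m = 0.
Proof.
move=> mi; rewrite [G]mpolyE mulr_suml raddf_sum big1 //= => p _.
rewrite -scalerAl -mpolyXD mcoeffZ mcoeffX.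
case: eqP => [e|_]; last by rewrite mulr0.
by move: mi; rewrite -e mnmDE mnm1E eqxx addn1.
Qed.

(** A monomial with a nonstandard exponent is either a multiple of ['X_i] or divides no [M j], and
    in the latter case it is apolar to all of them. Conversely, neither summand of the ideal has a
    coefficient at a standard exponent. *)
Lemma standard_coefs_eq0 G :
  (standard_coefs G == 0) = (G \in apolar_sum_ideal M i).
Proof.
apply/eqP/apolar_sum_idealP => [G0 | [p [q [qM ->]]]]; last first.
  apply/rowP => k; have [j kj] := standard_exponent_dvd k.
  rewrite !mxE mcoeffD mcoeff_mulXU_eq0 ?standard_exponent_var // add0r.
  exact: (proj1 (apolar_monomialP _ _) (qM j)).
apply/apolar_sum_idealP; rewrite [G]mpolyE; apply: rpred_sum => m _.
have [Gm0|Gm0] := eqVneq G@_m 0; first by rewrite Gm0 scale0r rpred0.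
apply: rpredZ; apply/apolar_sum_idealP.
have [mi|mi] := eqVneq (m i) 0%N; last first.
  exists 'X_[m - U_(i)], 0; split; first by move=> j; apply: (raddf0 (diff_actionl _)).
  by rewrite addr0 -mpolyXD submK // lep1mP.
exists 0, 'X_[m]; rewrite mul0r add0r; split=> // j.
apply/apolar_monomialP => p pa; rewrite mcoeffX.
case: eqP => // mp; rewrite -{}mp in pa.
have [k km] := standard_exponent_surj m j mi pa.
by move/rowP/(_ k)/eqP: G0; rewrite !mxE km (negPf Gm0).
Qed.

Lemma standard_coefs_surj (v : 'rV_#|D|) : exists G, standard_coefs G = v.
Proof.
exists (\sum_k v 0 k *: 'X_[standard_exponent k]); apply/rowP => k.
rewrite mxE raddf_sum (bigD1 k) //= mcoeffZ mcoeffX eqxx mulr1 big1 ?addr0 // => k' k'k.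
rewrite mcoeffZ mcoeffX; case: eqP => [e|_]; last by rewrite mulr0.
by case/eqP: k'k; apply: standard_exponent_inj.
Qed.

(** The map [standard_coefs] is linear and onto with the ideal as kernel, so it descends to an
    isomorphism, built here from chosen representatives. *)
Lemma apolar_quotient_vector :
  inhabited (Vector.axiom #|D| (mod_quot (apolar_sum_ideal M i))).
Proof.
pose S : submodClosed {mpoly K[n]} := apolar_sum_ideal M i.
pose HL := GRing.isLinear.Build K {mpoly K[n]} 'rV_#|D| _ standard_coefs standard_coefs_linear.
pose f : {linear {mpoly K[n]} -> 'rV_#|D|} := HB.pack standard_coefs HL.
have f_eq G H : (f G = f H) <-> (mod_pi S G = mod_pi S H).
  rewrite mod_piP -standard_coefs_eq0 -[standard_coefs _]/(f _) raddfB subr_eq0.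
  by split=> /eqP.
pose lift (u : mod_quot S) := sval (cid (mod_pi_surj u)).
have liftE u : mod_pi S (lift u) = u := esym (svalP (cid (mod_pi_surj u))).
pose pre v := sval (cid (standard_coefs_surj v)).
have preE v : f (pre v) = v := svalP (cid (standard_coefs_surj v)).
constructor; exists (fun u => f (lift u)).
  move=> c u v; rewrite -linearP; apply/f_eq.
  by rewrite linearP /= !liftE.
exists (fun v => mod_pi S (pre v)) => [u|v].
  by rewrite -[RHS]liftE; apply/f_eq; rewrite preE.
by rewrite -[RHS]preE; apply/f_eq; rewrite liftE.
Qed.

(* The extra factor X_i makes the evaluations vanish at the points lying on the
   hyperplane X_i = 0; at the other points a power of X_i can be cancelled to
   pass from the degree exponent_bound to the top degree of the combination. *)
Lemma standard_exponents_le_waring r :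
  (forall j, 0 < a j i)%N -> simultaneous_waring M r -> (#|D| <= r)%N.
Proof.
move=> ai [L [Lhom [lam ML]]]; rewrite leqNgt; apply/negP => rD.
(* Completes a standard exponent to degree [t] by a power of ['X_i], provided its degree is at most
   [t]. *)
pose e t (k : 'I_#|D|) : 'X_{1..n} := (enum_val k + U_(i) *+ (t - mdeg (standard_exponent k)))%MM.
pose A : 'M[K]_(#|D|, r) :=
  \matrix_(k, s) ('X_[e exponent_bound k]).@[linear_coef (L s)].
(* More rows than columns force a linear relation [c] between the rows. *)
have : kermx A != 0.
  rewrite kermx_eq0 -row_leq_rank -ltnNge.
  exact: leq_ltn_trans (rank_leq_col A) rD.
case/rowV0Pn => c /sub_kermxP cA /rV0Pn [k0' ck0'].
pose deg (k : 'I_#|D|) := mdeg (standard_exponent k).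
case: (@arg_maxnP _ k0' (fun k => c 0 k != 0) deg ck0') => k0 ck0 k0max.
have max_k0 k : c 0 k != 0 -> (deg k <= deg k0)%N by apply: k0max.
(* On the support of [c] the degrees are at most [deg k0], so each term has degree exactly
   [(deg k0).+1] and at least one factor ['X_i]. *)
pose G := \sum_(k | c 0 k != 0) c 0 k *: 'X_[e (deg k0).+1 k] : {mpoly K[n]}.
have Ghom : G \is (deg k0).+1.-homog.
  apply: rpred_sum => k ck; apply: rpredZ; rewrite dhomogX /= mdegD mdegMn mdeg1.
  by rewrite mul1n subnKC // leqW // max_k0.
have G0 s : G.@[linear_coef (L s)] = 0.
  pose l := linear_coef (L s).
  have Xe t k : ('X_[e t k]).@[l] = ('X_[standard_exponent k]).@[l] * l i ^+ (t - deg k).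
    by rewrite mpolyXD mevalM -mpolyXn rmorphXn /= mevalXU.
  have Gl : G.@[l] = \sum_(k | c 0 k != 0) c 0 k * ('X_[e (deg k0).+1 k]).@[l].
    by rewrite raddf_sum /=; apply: eq_bigr => k _; rewrite mevalZ.
  have [li|li] := eqVneq (l i) 0.
    rewrite Gl big1 // => k ck; rewrite Xe li subSn ?max_k0 //.
    by rewrite exprS mul0r !mulr0.
  have lt_k0 : (deg k0 < exponent_bound)%N := valP (enum_val k0).
  apply: (mulfI (expf_neq0 (exponent_bound - (deg k0).+1) li)).
  rewrite mulr0 Gl mulr_sumr.
  have := congr1 (fun v : 'rV_ _ => v 0 s) cA; rewrite !mxE => cAs.
  rewrite -[RHS]cAs [RHS](bigID (fun k => c 0 k != 0)) /= [X in _ = _ + X]big1 ?addr0; last first.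
    by move=> k /negPn /eqP ->; rewrite mul0r.
  apply: eq_bigr => k ck; rewrite mxE !Xe mulrCA; congr (_ * _).
  rewrite mulrCA -exprD; congr (_ * _ ^+ _).
  by rewrite addnBA ?leqW ?max_k0 // subnK.
have GM j : diff_action G (M j) = 0.
  rewrite ML raddf_sum big1 //= => s _.
  by rewrite linearZ /= (diff_action_linear_exp _ _ _ _ (Lhom s) Ghom) G0 mulr0 scale0r scaler0.
have [j k0j] := standard_exponent_dvd k0.
have := proj1 (apolar_monomialP _ _) (GM j) (e (deg k0).+1 k0).
have -> : (e (deg k0).+1 k0 <= a j)%MM.
  apply/mnm_lepP => i'; rewrite /e subSnn mnmDE mulmnE muln1 mnm1E.
  case: (eqVneq i i') => [<-|_]; first by rewrite standard_exponent_var ai.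
  by rewrite addn0; apply/mnm_lepP.
move=> /(_ isT) /eqP; rewrite raddf_sum (bigD1 k0) //= mcoeffZ mcoeffX eqxx mulr1.
rewrite big1 ?addr0 ?(negPf ck0) // => k /andP [ck kk0].
rewrite mcoeffZ mcoeffX; case: eqP => [ek|_]; last by rewrite mulr0.
(* Standard exponents are 0 at [i], so they are determined by their other entries, which [e] leaves
   unchanged. *)
case/eqP: kk0; apply/standard_exponent_inj/mnmP => i'.
have := congr1 (fun m : 'X_{1..n} => m i') ek.
rewrite !mnmDE !mulmnE !mnm1E; case: (eqVneq i i') => [<- _|_].
  by rewrite !standard_exponent_var.
by rewrite !addn0.
Qed.

(** Since some decomposition exists, a least length exists and [xget] does not return its default
    0. *)
Lemma simultaneous_waring_rankP : simultaneous_waring M (simultaneous_waring_rank M).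
Proof.
rewrite /simultaneous_waring_rank; case: xgetP => [r _ [] //|no_min].
have [r0 Mr0] := simultaneous_waring_monomials.
have ex_r : exists r, `[< simultaneous_waring M r >] by exists r0; apply/asboolP.
case: (ex_minnP ex_r) => r /asboolP Mr min_r; case: (no_min r); split=> // s Ms.
exact/min_r/asboolP.
Qed.

End Monomials.

End Apolarity.

Theorem proposition2p2 (R : realType) (n : nat) (J : finType)
    (a : J -> 'X_{1..n.+1}) :
  (0 < #|J|)%N ->
  (forall (j : J) (i : 'I_n.+1), (1 <= a j i)%N) ->
  forall i : 'I_n.+1,
  let M : J -> {mpoly R[i][n.+1]} := fun j => 'X_[a j] in
  exists d : nat,
    inhabited (Vector.axiom d (mod_quot (apolar_sum_ideal M i))) /\
    (d <= simultaneous_waring_rank M)%N.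
Proof.
move=> _ a1 i M; have char0 := Num.Theory.pchar_num R[i].
exists #|standard_exponents _ J a i|; split.
  exact: apolar_quotient_vector.
apply: (standard_exponents_le_waring _ _ char0) => [j|]; first exact: a1.
exact: simultaneous_waring_rankP.
Qed.
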